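(* Consider the modified connectivity query obtained from the query \texttt{connected(u, v)} described in the context by omitting its last root search and re-check (the final ``if $\texttt{find\_root}(u) \neq (r_u, V_u)$, restart'' executed in the case $r_u \neq r_v$). Then the modified query is not linearizable: there is an execution with one reader and the single writer in which the modified \texttt{connected(u, v)} returns \texttt{false} although $u$ and $v$ were in the same connected component at every moment during the invocation.
   Context: Shared-memory model with asynchronous threads; single-word reads and writes are atomic. A forest is stored as a collection of nodes, each with a \texttt{parent} pointer (\texttt{null} iff root) and an integer \texttt{version}; the connected components are the sets of nodes reaching the same root by parent pointers. Only a single writer thread performs modifications (edge additions/removals), one at a time; each modification, before doing anything else, increments the \texttt{version} of every node that is a root of an affected component before the modification or becomes such a root by it, and its logical merge/split takes effect at a single write of one parent pointer. Readers use \texttt{find\_root(w)}: starting at $w$, follow parent pointers until a node whose \texttt{parent} is \texttt{null} is read, then return that node with its current \texttt{version} (read afterwards). The query \texttt{connected(u, v)} loops: $(r_u, V_u) := \texttt{find\_root}(u)$; $(r_v, V_v) := \texttt{find\_root}(v)$; if $\texttt{find\_root}(u) \neq (r_u, V_u)$ restart; if $r_u \neq r_v$: if $\texttt{find\_root}(v) \neq (r_v, V_v)$ restart, then if $\texttt{find\_root}(u) \neq (r_u, V_u)$ restart; return whether $r_u = r_v$. *)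

(* Defs.v *)
From mathcomp Require Import all_boot.

Set Implicit Arguments.
Unset Strict Implicit.
Unset Printing Implicit Defensive.

(** * Shared memory *)

Record memory (V : finType) := Memory {
  parent : V -> option V;
  version : V -> nat
}.

(* The writer is the only thread that writes, so incrementing a version is one
   atomic single-word write of a value known to the writer. *)
Inductive write (V : finType) :=
  | IncVersion of V
  | SetParent of V & option V.

Definition do_write (V : finType) (m : memory V) (w : write V) : memory V :=
  match w with
  | IncVersion x =>
      Memory (parent m)
             (fun y => if y == x then (version m y).+1 else version m y)
  | SetParent x p =>
      Memory (fun y => if y == x then p else parent m y) (version m)
  end.

Definition do_writes (V : finType) : memory V -> seq (write V) -> memory V :=
  foldl (@do_write V).

Definition parent_rel (V : finType) (m : memory V) : rel V :=
  fun x y => parent m x == Some y.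

Definition root_of (V : finType) (m : memory V) (x r : V) : bool :=
  connect (parent_rel m) x r && (parent m r == None).

Definition same_component (V : finType) (m : memory V) (x y : V) : bool :=
  [exists r, root_of m x r && root_of m y r].

(** * Modifications *)

Definition graph (V : finType) := {set {set V}}.

Definition adj (V : finType) (E : graph V) : rel V :=
  fun x y => [set x; y] \in E.

Inductive modification (V : finType) :=
  | AddEdge of V & V
  | RemoveEdge of V & V.

Definition endpoints (V : finType) (o : modification V) : V * V :=
  match o with AddEdge a b => (a, b) | RemoveEdge a b => (a, b) end.

Definition modify (V : finType) (o : modification V) (E : graph V) : graph V :=
  match o with
  | AddEdge a b => [set a; b] |: E
  | RemoveEdge a b => E :\ [set a; b]
  end.

(* The graph is a forest: only edges between distinct components are added, and
   only present edges are removed. *)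
Definition enabled (V : finType) (o : modification V) (E : graph V) : bool :=
  match o with
  | AddEdge a b => ~~ connect (adj E) a b
  | RemoveEdge a b => [set a; b] \in E
  end.

(* Instantiating [x = y] shows that every node then reaches a root, i.e. that
   the parent pointers are acyclic. *)
Definition represents (V : finType) (m : memory V) (E : graph V) : Prop :=
  forall x y, same_component m x y = connect (adj E) x y.

Definition affected_root (V : finType) (m : memory V) (o : modification V)
    (r : V) : bool :=
  root_of m (endpoints o).1 r || root_of m (endpoints o).2 r.

Definition set_parents (V : finType) (s : seq (V * option V)) : seq (write V) :=
  [seq SetParent xp.1 xp.2 | xp <- s].

(* [implements m E o ws]: from memory [m], representing [E], the single-word
   writes [ws] are a correct way of carrying out [o].  The versions of the
   affected roots (before or after) are incremented first, in any order; then
   come parent writes, of which the one setting the parent of [x] to [p] is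
   where the logical merge or split takes effect: the represented components are
   the old ones at every moment before it and the new ones ever after. *)
Definition implements (V : finType) (m : memory V) (E : graph V)
    (o : modification V) (ws : seq (write V)) : Prop :=
  enabled o E /\
  exists (bumps : seq V) (pre : seq (V * option V)) (x : V) (p : option V)
         (post : seq (V * option V)),
    let m0 := do_writes m [seq IncVersion r | r <- bumps] in
    let m1 := do_writes m0 (set_parents pre) in
    let m2 := do_write m1 (SetParent x p) in
    [/\ ws = [seq IncVersion r | r <- bumps] ++ set_parents pre
               ++ SetParent x p :: set_parents post,
        uniq bumps,
        forall r, (r \in bumps) =
          affected_root m o r || affected_root (do_writes m ws) o r,
        forall k, represents (do_writes m0 (set_parents (take k pre))) E
      & forall k, represents (do_writes m2 (set_parents (take k post)))
                             (modify o E)].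

(** * Queries *)

(* Local state of a reader inside a query.  [FindRoot w k] is about to read
   [w.parent]; [ReadVersion r k] has read [r.parent = null] and is about to read
   [r.version]; [k] is the continuation receiving the result of find_root. *)
Inductive program (V : finType) :=
  | Return of bool
  | Restart
  | FindRoot of V & (V * nat -> program V)
  | ReadVersion of V & (V * nat -> program V).

Arguments Return {V}.
Arguments Restart {V}.

(* One step of a query with body [body], performing at most one read. *)
Definition read_step (V : finType) (m : memory V) (body : program V)
    (p : program V) : program V :=
  match p with
  | Return b => Return b
  | Restart => body
  | FindRoot w k =>
      if parent m w is Some w' then FindRoot w' k else ReadVersion w k
  | ReadVersion r k => k (r, version m r)
  end.

Definition connected_body (last_recheck : bool) (V : finType) (u v : V) :
    program V :=
  FindRoot u (fun ru =>
  FindRoot v (fun rv =>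
  FindRoot u (fun ru' =>
    if ru' != ru then Restart
    else if ru.1 != rv.1 then
      FindRoot v (fun rv' =>
        if rv' != rv then Restart
        else if last_recheck then
          FindRoot u (fun ru'' =>
            if ru'' != ru then Restart
            else Return (ru.1 == rv.1))
        else Return (ru.1 == rv.1))
    else Return (ru.1 == rv.1)))).

Definition query := forall V : finType, V -> V -> program V.

Definition connected_query : query := connected_body true.
Definition modified_query : query := connected_body false.

(** * Executions *)

(* [None] is the writer, [Some i] the [i]-th reader. *)
Definition thread (n : nat) := option 'I_n.

Inductive operation (V : finType) :=
  | Modify of modification V
  | Connected of V & V.

Inductive response := Done | Answer of bool.

Inductive event (V : finType) (n : nat) :=
  | Inv of thread n & operation V
  | Res of thread n & response.

Arguments Inv {V n}.
Arguments Res {V n}.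

Definition thread_of (V : finType) (n : nat) (e : event V n) : thread n :=
  match e with Inv t _ => t | Res t _ => t end.

(* [edges] is ghost state: the graph resulting from the completed
   modifications.  [writer] is the current modification with its remaining
   writes; [readers i] is the current query of reader [i] and its arguments. *)
Record config (V : finType) (n : nat) := Config {
  shared : memory V;
  edges : graph V;
  writer : option (modification V * seq (write V));
  readers : 'I_n -> option (V * V * program V)
}.

Definition set_reader (V : finType) (n : nat) (c : config V n) (i : 'I_n)
    (s : option (V * V * program V)) : config V n :=
  Config (shared c) (edges c) (writer c)
         (fun j => if j == i then s else readers c j).

Definition init (V : finType) (n : nat) : config V n :=
  Config (Memory (fun _ => None) (fun _ => 0)) set0 None (fun _ => None).

Inductive step (q : query) (V : finType) (n : nat) (c : config V n) :
    option (event V n) -> config V n -> Prop :=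
  | StepModify o ws of
      writer c = None & implements (shared c) (edges c) o ws :
      step q c (Some (Inv None (Modify o)))
        (Config (shared c) (edges c) (Some (o, ws)) (readers c))
  | StepWrite o w ws of writer c = Some (o, w :: ws) :
      step q c None
        (Config (do_write (shared c) w) (edges c) (Some (o, ws)) (readers c))
  | StepDone o of writer c = Some (o, [::]) :
      step q c (Some (Res None Done))
        (Config (shared c) (modify o (edges c)) None (readers c))
  | StepQuery i u v of readers c i = None :
      step q c (Some (Inv (Some i) (Connected u v)))
        (set_reader c i (Some (u, v, q V u v)))
  | StepRead i u v p of readers c i = Some (u, v, p) :
      step q c None
        (set_reader c i (Some (u, v, read_step (shared c) (q V u v) p)))
  | StepAnswer i u v b of readers c i = Some (u, v, Return b) :
      step q c (Some (Res (Some i) (Answer b))) (set_reader c i None).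

(* Each step is listed as its visible event, if any, and the configuration it
   leads to. *)
Definition trace (V : finType) (n : nat) :=
  seq (option (event V n) * config V n).

Fixpoint execution (q : query) (V : finType) (n : nat) (c : config V n)
    (tr : trace V n) : Prop :=
  if tr is (l, c') :: tr' then step q c l c' /\ execution q c' tr' else True.

Definition history (V : finType) (n : nat) (tr : trace V n) :
    seq (event V n) := pmap fst tr.

(** * Linearizability (Herlihy and Wing) *)

Fixpoint legal (V : finType) (E : graph V) (s : seq (operation V * response)) :
    Prop :=
  match s with
  | [::] => True
  | (Modify o, Done) :: s' => legal (modify o E) s'
  | (Connected u v, Answer b) :: s' => b = connect (adj E) u v /\ legal E s'
  | _ => False
  end.

(* Operations of a history are identified with the positions of their
   invocations; the one invoked at [i] gets response [r] at position [j]. *)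
Definition responds (V : finType) (n : nat) (h : seq (event V n)) (i j : nat)
    (r : response) : Prop :=
  exists (t : thread n) (o : operation V),
    [/\ i < j, onth h i = Some (Inv t o), onth h j = Some (Res t r)
      & forall k e, i < k < j -> onth h k = Some e -> thread_of e != t].

(* [s] lists the linearized operations: all completed ones, with their actual
   responses, and possibly some pending ones, with any response. *)
Definition linearizable_history (V : finType) (n : nat)
    (h : seq (event V n)) : Prop :=
  exists (s : seq nat) (op : nat -> operation V) (res : nat -> response),
    [/\ uniq s,
        forall i, i \in s -> exists t, onth h i = Some (Inv t (op i)),
        forall i j r, responds h i j r -> i \in s /\ res i = r,
        forall i j r i', responds h i j r -> i' \in s -> j < i' ->
          index i s < index i' s
      & legal set0 [seq (op i, res i) | i <- s]].

Definition linearizable (q : query) : Prop :=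
  forall (V : finType) (n : nat) (tr : trace V n),
    execution q (init V n) tr -> linearizable_history (history tr).

(* Main.v *)
Require Import Defs.
From mathcomp Require Import all_boot.

Set Implicit Arguments.
Unset Strict Implicit.
Unset Printing Implicit Defensive.

(** Let [u] be a root with [v -> x -> u], over the edges [x v] and [v u].  The
    writer starts removing the edge [x v] and has incremented the versions of
    [u] and [x] when the query starts.  The reader finds the root [u] from [u]
    and reads that the parent of [v] is [x].  The writer then moves [v] directly
    below [u], cuts [x] off and starts adding the edge [u x], incrementing the
    version of [x] only.  The suspended search from [v] ends in the root [x],
    and the re-check of [u] still succeeds.  Finally the writer increments the
    version of [u] and makes [x] the parent of [u], so the re-check of [v] ends
    in [x] with an unchanged version as well, and the query answers [false].
    Since the edge [v u] is present throughout, no linearization point exists. *)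

(** * Roots *)

(** By [odflt y] a root is its own parent, so iterating too often is harmless and roots are found by
    evaluation. *)
Definition ancestor (V : finType) (m : memory V) (k : nat) (x : V) : V :=
  iter k (fun y => odflt y (parent m y)) x.

Lemma connect_ancestor (V : finType) (m : memory V) k x :
  connect (parent_rel m) x (ancestor m k x).
Proof.
elim: k => [|k IHk]; first exact: connect0.
apply: connect_trans IHk _; rewrite /ancestor iterS -/(ancestor m k x).
case Ep: (parent m (ancestor m k x)) => [y|] /=; last exact: connect0.
by apply: connect1; rewrite /parent_rel Ep.
Qed.

(** Parent pointers form a partial function: of two parent paths from [x] one is a prefix of the
    other, and none continues past a null parent. *)
Lemma root_of_inj (V : finType) (m : memory V) x r s :
  root_of m x r -> root_of m x s -> r = s.
Proof.
move=> /andP[/connectP[p xp ->{r}] pr] /andP[/connectP[q xq ->{s}] ps].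
elim: p q x xp xq pr ps => [|y p IHp] [|z q] x //=.
- by move=> _ /andP[/eqP-> _].
- by move=> /andP[/eqP-> _].
by move=> /andP[/eqP xy yp] /andP[]; rewrite /parent_rel xy => /eqP[<-]; apply: IHp.
Qed.

Section AncestorRoots.

Variables (V : finType) (m : memory V) (k : nat).
Hypothesis rooted : forall x, parent m (ancestor m k x) = None.

Lemma root_ofE x r : root_of m x r = (r == ancestor m k x).
Proof.
have root_x : root_of m x (ancestor m k x).
  by rewrite /root_of connect_ancestor rooted.
by apply/idP/eqP => [/root_of_inj/(_ root_x)|->].
Qed.

Lemma same_componentE x y :
  same_component m x y = (ancestor m k x == ancestor m k y).
Proof.
apply/existsP/eqP => [[r]|eq_xy].
  by rewrite !root_ofE => /andP[/eqP<- /eqP].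
by exists (ancestor m k x); rewrite !root_ofE eqxx eq_xy eqxx.
Qed.

End AncestorRoots.

Lemma same_component_ancestor (V : finType) (m : memory V) k x y :
  parent m (ancestor m k x) == None -> ancestor m k x == ancestor m k y ->
  same_component m x y.
Proof.
move=> root_x /eqP eq_xy; apply/existsP; exists (ancestor m k x).
by rewrite /root_of root_x {2}eq_xy !connect_ancestor.
Qed.

(** * Graphs *)

Lemma eq_set2 (T : finType) (a b c d : T) :
  ([set a; b] == [set c; d])
    = (a == c) && (b == d) || (a == d) && (b == c).
Proof.
apply/eqP/orP => [eq_s | [] /andP[/eqP-> /eqP->] //]; last exact: setUC.
have /set2P Ha : a \in [set c; d] by rewrite -eq_s set21.
have /set2P Hb : b \in [set c; d] by rewrite -eq_s set22.
have /set2P Hc : c \in [set a; b] by rewrite eq_s set21.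
have /set2P Hd : d \in [set a; b] by rewrite eq_s set22.
have [?|ac] := eqVneq a c.
  subst c; case: Hd => [?|->]; last by left; rewrite eqxx.
  by subst d; case: Hb => ->; left; rewrite eqxx.
case: Ha => [/eqP|?]; first by rewrite (negPf ac).
by subst d; right; case: Hc => [/eqP|->]; rewrite ?eqxx // eq_sym (negPf ac).
Qed.

Lemma adj_sym (V : finType) (E : graph V) : symmetric (adj E).
Proof. by move=> x y; rewrite /adj setUC. Qed.

(* [z] is a common neighbour of any two nodes of a component that are not
   adjacent; such a [z] exists in every graph on three nodes. *)
Lemma represents_ancestor (V : finType) (m : memory V) (E : graph V) k z :
  (forall x, parent m (ancestor m k x) = None) ->
  (forall x y, adj E x y -> ancestor m k x = ancestor m k y) ->
  (forall x, let r := ancestor m k x in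
     [|| x == r, adj E x r | adj E x z && adj E z r]) ->
  represents m E.
Proof.
move=> rooted adjA linkA x y; rewrite (same_componentE rooted).
have linked w : connect (adj E) w (ancestor m k w).
  have /or3P[/eqP<-|/connect1 //|/andP[wz zr]] := linkA w; first exact: connect0.
  exact: connect_trans (connect1 wz) (connect1 zr).
apply/eqP/idP => [eq_xy | /connectP[p xp ->{y}]].
  apply: connect_trans (linked x) _.
  by rewrite eq_xy (sym_connect_sym (@adj_sym _ E)) linked.
by elim: p x xp => //= y p IHp x /andP[/adjA-> /IHp].
Qed.

(** * Scheduled executions *)

(** An action determines its successor configuration, so a trace is computed from a list of
    actions. *)
Inductive action (V : finType) (n : nat) :=
  | DoModify of modification V & seq (write V)
  | DoWrite
  | DoDone
  | DoQuery of 'I_n & V & V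
  | DoRead of 'I_n
  | DoAnswer of 'I_n.

Arguments DoModify {V n}.
Arguments DoWrite {V n}.
Arguments DoDone {V n}.
Arguments DoQuery {V n}.
Arguments DoRead {V n}.
Arguments DoAnswer {V n}.

Section Schedules.

Variables (q : query) (V : finType) (n : nat).
Implicit Types (c : config V n) (a : action V n).

Definition admissible c a : Prop :=
  match a with
  | DoModify o ws => writer c = None /\ implements (shared c) (edges c) o ws
  | DoWrite => if writer c is Some (_, _ :: _) then True else False
  | DoDone => if writer c is Some (_, [::]) then True else False
  | DoQuery i _ _ => readers c i = None
  | DoRead i => if readers c i is Some _ then True else False
  | DoAnswer i => if readers c i is Some (_, Return _) then True else False
  end.

(* The result is meaningful only if the action is admissible. *)
Definition act c a : option (event V n) * config V n :=
  match a with
  | DoModify o ws =>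
      (Some (Inv None (Modify o)),
       Config (shared c) (edges c) (Some (o, ws)) (readers c))
  | DoWrite =>
      if writer c is Some (o, w :: ws) then
        (None, Config (do_write (shared c) w) (edges c) (Some (o, ws))
                      (readers c))
      else (None, c)
  | DoDone =>
      if writer c is Some (o, _) then
        (Some (Res None Done),
         Config (shared c) (modify o (edges c)) None (readers c))
      else (None, c)
  | DoQuery i u v =>
      (Some (Inv (Some i) (Connected u v)),
       set_reader c i (Some (u, v, q u v)))
  | DoRead i =>
      if readers c i is Some (u, v, p) then
        (None, set_reader c i (Some (u, v, read_step (shared c) (q u v) p)))
      else (None, c)
  | DoAnswer i =>
      if readers c i is Some (_, Return b) then
        (Some (Res (Some i) (Answer b)), set_reader c i None)
      else (None, c)
  end.

Lemma act_step c a : admissible c a -> step q c (act c a).1 (act c a).2.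
Proof.
case: a => [o ws||| i u v | i | i] /=.
- by case; apply: StepModify.
- by case Ew: (writer c) => [[o [|w ws]]|] //= _; apply: StepWrite.
- by case Ew: (writer c) => [[o [|w ws]]|] //= _; apply: StepDone.
- exact: StepQuery.
- by case Er: (readers c i) => [[[u v] p]|] //= _; apply: StepRead.
- case Er: (readers c i) => [[[u v] [b||?|?]]|] //= _.
  exact: StepAnswer Er.
Qed.

Fixpoint run c (s : seq (action V n)) : trace V n :=
  if s is a :: s' then act c a :: run (act c a).2 s' else [::].

Definition final c (s : seq (action V n)) : config V n :=
  foldl (fun d a => (act d a).2) c s.

Lemma run_cat c s t : run c (s ++ t) = run c s ++ run (final c s) t.
Proof. by elim: s c => //= a s IHs c; rewrite IHs. Qed.

Lemma run_bracket c s a t b (d := (act (final c s) a).2) :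
  run c (s ++ a :: t ++ [:: b])
    = run c s ++ act (final c s) a :: run d t ++ [:: act (final d t) b].
Proof. by rewrite run_cat /= run_cat. Qed.

Fixpoint runnable c (s : seq (action V n)) : Prop :=
  if s is a :: s' then admissible c a /\ runnable (act c a).2 s' else True.

Lemma run_execution c s : runnable c s -> execution q c (run c s).
Proof.
elim: s c => //= a s IHs c [/act_step + /IHs].
by case: (act c a).
Qed.

End Schedules.

(** * Linearizations *)

Definition keeps_edge (V : finType) (a b : V) (o : operation V) : bool :=
  if o is Modify (RemoveEdge c d) then [set c; d] != [set a; b] else true.

Section PersistentEdge.

Variables (V : finType) (a b : V).
Variables (op : nat -> operation V) (res : nat -> response).

(** No operation of [s] removes the edge, so it is still in the graph when the query is
    evaluated. *)
Lemma legal_answer_true E s k c :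
  adj E a b -> (forall i, i \in s -> keeps_edge a b (op i)) ->
  legal E [seq (op i, res i) | i <- s] ->
  k \in s -> op k = Connected a b -> res k = Answer c -> c = true.
Proof.
elim: s E => //= j s IHs E Eab keep; rewrite inE.
have keep_s i : i \in s -> keeps_edge a b (op i).
  by move=> si; apply: keep; rewrite inE si orbT.
have keep_j : keeps_edge a b (op j) by apply: keep; rewrite inE eqxx.
case: eqP => [->|_] /= lgl => [_ opk resk | ks].
  by move: lgl; rewrite opk resk => -[-> _]; apply: connect1.
case: (op j) (res j) keep_j lgl => [o|x y] [|d] //= keep_j.
  move=> lgl; apply: (IHs _ _ keep_s lgl ks).
  rewrite /adj; case: o lgl keep_j => x y /= _ keep_j.
    by rewrite inE [_ \in E]Eab orbT.
  by rewrite !inE eq_sym keep_j.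
by case=> _ lgl; apply: (IHs _ Eab keep_s lgl ks).
Qed.

Lemma legal_answer_after_add E s i k c :
  (forall i, i \in s -> keeps_edge a b (op i)) ->
  legal E [seq (op i, res i) | i <- s] ->
  op i = Modify (AddEdge a b) -> op k = Connected a b -> res k = Answer c ->
  k \in s -> index i s < index k s -> c = true.
Proof.
elim: s E => //= j s IHs E keep lgl opi opk resk; rewrite inE.
have keep_s l : l \in s -> keeps_edge a b (op l).
  by move=> sl; apply: keep; rewrite inE sl orbT.
rewrite ![j == _]eq_sym; case: (eqVneq k j) => //= _ ks.
case: (eqVneq i j) => [eq_ij _ | _]; last first.
  rewrite ltnS; case: (op j) (res j) lgl => [o|x y] [|d] //=.
    by move/IHs; apply.
  by case=> _ /IHs; apply.
(* The addition puts the edge into the graph, and the query lies in the rest of the sequence. *)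
move: lgl; rewrite -eq_ij opi; case: (res i) => //= lgl.
by apply: (legal_answer_true _ keep_s lgl ks opk resk); rewrite /adj setU11.
Qed.

End PersistentEdge.

(** * The counterexample *)

Definition node := option bool.
Definition nu : node := Some true.
Definition nv : node := Some false.
Definition nx : node := None.

Definition writes_xv : seq (write node) :=
  [:: IncVersion nx; IncVersion nv; SetParent nv (Some nx)].
Definition writes_uv : seq (write node) :=
  [:: IncVersion nx; IncVersion nu; SetParent nx (Some nu)].
Definition writes_cut : seq (write node) :=
  [:: IncVersion nu; IncVersion nx; SetParent nv (Some nu); SetParent nx None].
(* [x] comes before [u]: the reader runs between the two increments. *)
Definition writes_ux : seq (write node) :=
  [:: IncVersion nx; IncVersion nu; SetParent nu (Some nx)].

Definition before_query : seq (action node 1) :=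
  [:: DoModify (AddEdge nx nv) writes_xv; DoWrite; DoWrite; DoWrite; DoDone;
      DoModify (AddEdge nu nv) writes_uv; DoWrite; DoWrite; DoWrite; DoDone;
      DoModify (RemoveEdge nx nv) writes_cut; DoWrite; DoWrite].

(** The blocks of reads are: the search from [nu] and one step from [nv]; the end of that search at
    [nx] and the re-check of [nu]; the re-check of [nv] through [nu] to [nx]. *)
Definition during_query : seq (action node 1) :=
  [:: DoRead ord0; DoRead ord0; DoRead ord0;
      DoWrite; DoWrite; DoDone; DoModify (AddEdge nu nx) writes_ux; DoWrite;
      DoRead ord0; DoRead ord0; DoRead ord0; DoRead ord0;
      DoWrite; DoWrite;
      DoRead ord0; DoRead ord0; DoRead ord0; DoRead ord0].

Definition schedule : seq (action node 1) :=
  before_query ++ DoQuery ord0 nu nv :: during_query ++ [:: DoAnswer ord0].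

Definition counterexample : trace node 1 :=
  run modified_query (init node 1) schedule.

Definition memory0 := shared (init node 1).
Definition memory1 := do_writes memory0 writes_xv.
Definition memory2 := do_writes memory1 writes_uv.
Definition memory3 := do_writes memory2 writes_cut.

Definition edges1 : graph node := modify (AddEdge nx nv) set0.
Definition edges2 := modify (AddEdge nu nv) edges1.
Definition edges3 := modify (RemoveEdge nx nv) edges2.

(** On three nodes an acyclic parent chain has at most 2 links. *)
Ltac represents_by_cases z :=
  apply: (@represents_ancestor _ _ _ 2 z);
  [ by case=> [[]|]
  | by case=> [[]|] [[]|]; rewrite /adj /= ?inE ?eq_set2
  | by case=> [[]|]; rewrite /adj /= ?inE ?eq_set2 ].

Ltac bumps_by_cases :=
  case=> [[]|]; rewrite /affected_root !(@root_ofE _ _ 2) //;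
    by case=> [[]|].

Lemma represents0 : represents memory0 set0.
Proof. represents_by_cases nv. Qed.

Lemma represents1 : represents memory1 edges1.
Proof. represents_by_cases nv. Qed.

Lemma represents2 : represents memory2 edges2.
Proof. represents_by_cases nv. Qed.

Lemma represents3 : represents memory3 edges3.
Proof. represents_by_cases nv. Qed.

(** * Correctness of the four modifications *)

Lemma implements_xv :
  implements memory0 set0 (AddEdge nx nv) writes_xv.
Proof.
split; first by rewrite /= -represents0 (@same_componentE _ _ 2).
exists [:: nx; nv], [::], nv, (Some nx), [::]; split=> // [|k|k].
- bumps_by_cases.
- exact: represents0.
- exact: represents1.
Qed.

Lemma implements_uv :
  implements memory1 edges1 (AddEdge nu nv) writes_uv.
Proof.
split.
  by rewrite /= -represents1 (@same_componentE _ _ 2) //; case=> [[]|].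
exists [:: nx; nu], [::], nx, (Some nu), [::]; split=> // [|k|k].
- bumps_by_cases.
- exact: represents1.
- exact: represents2.
Qed.

Lemma implements_cut :
  implements memory2 edges2 (RemoveEdge nx nv) writes_cut.
Proof.
split; first by rewrite /= !inE eqxx orbT.
(* Moving [nv] below [nu] leaves the components unchanged; the split happens when the parent of [nx]
   becomes null. *)
exists [:: nu; nx], [:: (nv, Some nu)], nx, None, [::]; split=> // [|[|k]|k].
- bumps_by_cases.
- exact: represents2.
- represents_by_cases nv.
- exact: represents3.
Qed.

Lemma implements_ux :
  implements memory3 edges3 (AddEdge nu nx) writes_ux.
Proof.
split.
  by rewrite /= -represents3 (@same_componentE _ _ 2) //; case=> [[]|].
exists [:: nx; nu], [::], nu, (Some nx), [::]; split=> // [|k|k].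
- bumps_by_cases.
- exact: represents3.
(* The edges are now [nu nv] and [nu nx], so [nv] is linked to its root [nx] through [nu]. *)
- represents_by_cases nu.
Qed.

(** * The execution and its history *)

Lemma counterexample_execution :
  execution modified_query (init node 1) counterexample.
Proof.
apply: run_execution.
split; first by split; last exact: implements_xv.
do 4![split; first by []].
split; first by split; last exact: implements_uv.
do 4![split; first by []].
split; first by split; last exact: implements_cut.
do 9![split; first by []].
split; first by split; last exact: implements_ux.
by do !split.
Qed.

Lemma counterexample_not_linearizable :
  ~ linearizable_history (history counterexample).
Proof.
case=> s [op] [res] [_ opP resP orderP lgl].
have op_at i t o :
    i \in s -> onth (history counterexample) i = Some (Inv t o) -> op i = o.
  by move=> /opP[t' ->] [].
(* The edge [nu nv] is added at positions 2 to 3 of the history, before the query at positions 5 to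
   8. *)
have added : responds (history counterexample) 2 3 Done.
  by exists None, (Modify (AddEdge nu nv)); split=> // [] [|[|[|[|k]]]].
have answered : responds (history counterexample) 5 8 (Answer false).
  exists (Some ord0), (Connected nu nv); split=> //.
  by move=> [|[|[|[|[|[|[|[|k]]]]]]]] e //= _ [<-].
have [s2 _] := resP _ _ _ added.
have [s5 res5] := resP _ _ _ answered.
(* The only removal, at position 4, concerns the edge [nx nv]. *)
have keep i : i \in s -> keeps_edge nu nv (op i).
  move: i => [|[|[|[|[|[|[|[|[|i]]]]]]]]] /opP[t] //=;
    by [case: i | case=> _ <-; rewrite /= ?eq_set2].
have := legal_answer_after_add keep lgl (op_at _ _ _ s2 erefl).
move/(_ _ _ (op_at _ _ _ s5 erefl) res5 s5 (orderP _ _ _ _ added s5 isT)).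
by [].
Qed.

Theorem theorem4 :
  ~ linearizable modified_query /\
  exists (V : finType) (u v : V) (tr0 tr1 : trace V 1) (c c' : config V 1),
    [/\ u != v,
        execution modified_query (init V 1)
          (tr0 ++ (Some (Inv (Some ord0) (Connected u v)), c) :: tr1
               ++ [:: (Some (Res (Some ord0) (Answer false)), c')]),
        all (fun e => thread_of e == None) (history tr1)
      & all (fun d => same_component (shared d) u v)
          (c :: [seq lc.2 | lc <- tr1] ++ [:: c'])].
Proof.
split.
  by move=> /(_ _ _ _ counterexample_execution)/counterexample_not_linearizable.
pose c0 := final modified_query (init node 1) before_query.
pose c := (act modified_query c0 (DoQuery ord0 nu nv)).2.
pose c1 := final modified_query c during_query.
pose c' := (act modified_query c1 (DoAnswer ord0)).2.
exists node, nu, nv, (run modified_query (init node 1) before_query),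
  (run modified_query c during_query), c, c'.
split=> //.
  have := counterexample_execution.
  rewrite /counterexample /schedule run_bracket -/c0 -/c -/c1.
  (* Evaluating the schedule shows that the reader has reached [Return false]. *)
  suff -> : act modified_query c1 (DoAnswer ord0)
    = (Some (Res (Some ord0) (Answer false)), c') by [].
  by rewrite [LHS]surjective_pairing; congr pair.
(* This stronger test on grandparents is decided by evaluation in each configuration. *)
apply: (@sub_all _ (fun d =>
  (parent (shared d) (ancestor (shared d) 2 nu) == None) &&
  (ancestor (shared d) 2 nu == ancestor (shared d) 2 nv))).
  by move=> d /andP[]; apply: same_component_ancestor.
exact: erefl.
Qed.
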